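(* Let $y=y^\dagger+\varepsilon\in\mathbb R^m$ with $y^\dagger\in\operatorname{ran}(A)$ and $\varepsilon\in\mathbb R^m$, and let $\rho(t,u)$ solve the mean-field dynamics of stochastic EKI, $$\partial_t\rho=\operatorname{div}\left(\rho\,\mathfrak C(t)A^T\Gamma^{-1}(Au-y)\right)+\tfrac12\operatorname{Tr}\left(D^2\rho\;\mathfrak C(t)A^T\Gamma^{-1}A\,\mathfrak C(t)\right),\qquad t\ge 0,$$ where $\mathfrak m(t)=\int u\,d\rho(t,u)$, $\mathfrak C(t)=\int(u-\mathfrak m(t))(u-\mathfrak m(t))^T\,d\rho(t,u)$, $\mathfrak m_0=\mathfrak m(0)$ and $\mathfrak C_0=\mathfrak C(0)$. Let $u\in\mathbb R^n$ be an arbitrary element satisfying $Au=y^\dagger$. Then $$\mathfrak m(t)=\mathfrak m_0+\left(E-\mathfrak C(t)\mathfrak C_0^{-1}\right)(u-\mathfrak m_0)+t\,\mathfrak C(t)A^T\Gamma^{-1}\varepsilon\qquad(t\ge0),$$ $$\lim_{t\to\infty}\mathfrak m(t)=\mathfrak m^\dagger+(A^T\Gamma^{-1}A)^-(A^T\Gamma^{-1}\varepsilon),$$ where, with $\mathfrak C_\infty=\lim_{t\to\infty}\mathfrak C(t)$, $\mathfrak m^\dagger=\mathfrak m_0+(E-\mathfrak C_\infty\mathfrak C_0^{-1})(u-\mathfrak m_0)$ is equivalently characterized by $$\mathfrak m^\dagger=\operatorname{arg\,min}\{\|v-\mathfrak m_0\|_{\mathfrak C_0}: v\in\mathbb R^n,\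 Av=y^\dagger\}.$$ Alternatively, $$\lim_{t\to\infty}\mathfrak m(t)=\operatorname{arg\,min}\{\|v-\mathfrak m_0\|_{\mathfrak C_0}: v\in\mathbb R^n,\ Av=\Pi^\Gamma_{\operatorname{ran}(A)}(y)\}.$$ The rate of convergence of $\mathfrak m(t)$ to $\mathfrak m_\infty:=\lim_{t\to\infty}\mathfrak m(t)$ is $1/t$, i.e. $\|\mathfrak m(t)-\mathfrak m_\infty\|=O(1/t)$ as $t\to\infty$.
   Context: $A\in\mathbb R^{m\times n}$; $\Gamma\in\mathbb R^{m\times m}$ is symmetric positive definite; $\mathfrak C_0\in\mathbb R^{n\times n}$ is assumed symmetric positive definite; $E$ is the $n\times n$ identity. $D^2\rho$ is the Hessian in $u$ and $\operatorname{div}$ is the divergence in $u$. A solution $\rho(t,\cdot)$ is a family of probability measures on $\mathbb R^n$ (densities) with finite second moments, regular and decaying enough that the equation may be tested against polynomials of degree at most two: for each such polynomial $\varphi$, $t\mapsto\int\varphi\,d\rho(t,u)$ is continuously differentiable and $$\frac{d}{dt}\int\varphi\,d\rho=\int\left[-\langle\nabla\varphi(u),\mathfrak C(t)A^T\Gamma^{-1}(Au-y)\rangle+\tfrac12\operatorname{Tr}\left(D^2\varphi(u)\,\mathfrak C(t)A^T\Gamma^{-1}A\,\mathfrak C(t)\right)\right]d\rho(t,u).$$ (In particular $\dot{\mathfrak m}=-\mathfrak CA^T\Gamma^{-1}(A\mathfrak m-y)$ and $\dot{\mathfrak C}=-\mathfrak CA^T\Gamma^{-1}A\,\mathfrak C$.)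 For a symmetric positive definite $H$, $\langle x,z\rangle_H:=\langle x,H^{-1}z\rangle$ and $\|x\|_H^2:=\langle x,H^{-1}x\rangle$. $\Pi_V^\Gamma$ is the orthogonal projection onto a subspace $V\subset\mathbb R^m$ with respect to $\langle\cdot,\cdot\rangle_\Gamma$. The matrix $\mathfrak C_0A^T\Gamma^{-1}A$ is diagonalizable, $\mathfrak C_0A^T\Gamma^{-1}A=SDS^{-1}$ with $D=\operatorname{diag}(\mu_1,\dots,\mu_k,0,\dots,0)$, $\mu_1\ge\dots\ge\mu_k>0$. Set $D^+=\operatorname{diag}(\mu_1^{-1},\dots,\mu_k^{-1},0,\dots,0)$ and $(A^T\Gamma^{-1}A)^-:=(\mathfrak C_0A^T\Gamma^{-1}A)^+\mathfrak C_0:=SD^+S^{-1}\mathfrak C_0$ (not the Moore–Penrose inverse in general). *)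

(* Defs.v *)
From HB Require Import structures.
From mathcomp Require Import all_boot all_order all_algebra.
From mathcomp Require Import all_classical all_reals all_analysis.
Import Order.TTheory GRing.Theory Num.Theory.
Import numFieldNormedType.Exports.

Set Implicit Arguments.
Unset Strict Implicit.
Unset Printing Implicit Defensive.

Local Open Scope classical_set_scope.
Local Open Scope ring_scope.

(* R^n, as column vectors, with its Borel sigma-algebra. *)
Definition borel_cV (R : realType) (n : nat) :=
  g_sigma_algebraType (@open 'cV[R]_n).

Section LinearAlgebra.
Context {R : realType}.

Definition spd (n : nat) (H : 'M[R]_n) : Prop :=
  H^T = H /\ forall x : 'cV[R]_n, x != 0 -> 0 < (x^T *m H *m x) 0 0.

Definition wdot (n : nat) (H : 'M[R]_n) (x z : 'cV[R]_n) : R :=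
  (x^T *m invmx H *m z) 0 0.

Definition wnorm (n : nat) (H : 'M[R]_n) (x : 'cV[R]_n) : R :=
  Num.sqrt (wdot H x x).

(* The library norm of a matrix is the sup norm; this is the Euclidean one. *)
Definition enorm (n : nat) (x : 'cV[R]_n) : R :=
  Num.sqrt ((x^T *m x) 0 0).

Definition ran (m n : nat) (A : 'M[R]_(m, n)) : set 'cV[R]_m :=
  range (fun x : 'cV[R]_n => A *m x).

Definition is_orth_proj (m : nat) (G : 'M[R]_m) (V : set 'cV[R]_m)
    (y p : 'cV[R]_m) : Prop :=
  V p /\ forall v, V v -> wdot G (y - p) v = 0.

(* When V is a linear subspace and G is positive definite there is exactly one
   such point; the default value 0 is only used if there is none. *)
Definition orth_proj (m : nat) (G : 'M[R]_m) (V : set 'cV[R]_m)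
    (y : 'cV[R]_m) : 'cV[R]_m :=
  xget 0 [set p | is_orth_proj G V y p].

Definition is_argmin (T : Type) (F : set T) (f : T -> R) (x : T) : Prop :=
  F x /\ forall v, F v -> v <> x -> f x < f v.

(* diag (mu 0, ..., mu (k - 1), 0, ..., 0) *)
Definition pad_diag (n k : nat) (mu : nat -> R) : 'M[R]_n :=
  diag_mx (\row_(i < n) if (i < k)%N then mu i else 0).

Definition is_diagonalization (n : nat) (M S : 'M[R]_n) (k : nat)
    (mu : nat -> R) : Prop :=
  [/\ S \in unitmx,
      (k <= n)%N,
      forall i, (i < k)%N -> 0 < mu i,
      forall i j, (i <= j)%N -> (j < k)%N -> mu j <= mu i
    & M = S *m pad_diag n k mu *m invmx S].

(* The generalised inverse S D^+ S^-1 C0. *)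
Definition ginv (n : nat) (C0 S : 'M[R]_n) (k : nat) (mu : nat -> R) : 'M[R]_n :=
  S *m pad_diag n k (fun i => (mu i)^-1) *m invmx S *m C0.

End LinearAlgebra.

Section MeanField.
Context {R : realType} {n : nat}.
Implicit Types (P : probability (borel_cV R n) R) (phi : 'cV[R]_n -> R).

Definition finite_second_moment P : Prop :=
  (\int[P]_u (((u : 'cV[R]_n)^T *m u) 0%R 0%R)%:E < +oo)%E.

Definition mean P : 'cV[R]_n :=
  \col_i \int[P]_u ((u : 'cV[R]_n) i 0).

Definition cov P : 'M[R]_n :=
  \matrix_(i, j) \int[P]_u
    (((u : 'cV[R]_n) - mean P) *m ((u : 'cV[R]_n) - mean P)^T) i j.

Definition degree_le2 phi : Prop :=
  exists (Q : 'M[R]_n) (b : 'cV[R]_n) (c : R),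
    forall u, phi u = (u^T *m Q *m u) 0 0 + (b^T *m u) 0 0 + c.

Definition grad phi (u : 'cV[R]_n) : 'cV[R]_n :=
  \col_i 'D_(delta_mx i 0) phi u.

Definition hess phi (u : 'cV[R]_n) : 'M[R]_n :=
  \matrix_(i, j) 'D_(delta_mx j 0) (fun w => 'D_(delta_mx i 0) phi w) u.

(* l is the derivative of F at t relative to [0, +oo[ : two-sided for t > 0,
   one-sided at t = 0. *)
Definition halfline_derivative (F : R -> R) (t l : R) : Prop :=
  (fun s => (F s - F t) / (s - t)) @ within [set s | 0 <= s] t^' --> l.

Definition eki_generator (m : nat) (A : 'M[R]_(m, n)) (G : 'M[R]_m)
    (y : 'cV[R]_m) (C : 'M[R]_n) phi (u : 'cV[R]_n) : R :=
  - ((grad phi u)^T *m (C *m A^T *m invmx G *m (A *m u - y))) 0 0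
  + 2^-1 * \tr (hess phi u *m (C *m A^T *m invmx G *m A *m C)).

(* Weak form of
     d_t rho = div (rho C A^T G^-1 (A u - y)) + 1/2 Tr (D^2 rho C A^T G^-1 A C)
   tested against the polynomials of degree at most two.  Only the values
   rho t with 0 <= t matter. *)
Definition mean_field_eki (m : nat) (A : 'M[R]_(m, n)) (G : 'M[R]_m)
    (y : 'cV[R]_m) (rho : R -> probability (borel_cV R n) R) : Prop :=
  (forall t, 0 <= t -> finite_second_moment (rho t)) /\
  forall phi, degree_le2 phi ->
    let F t := \int[rho t]_u phi u in
    let dF t := \int[rho t]_u eki_generator A G y (cov (rho t)) phi u in
    (forall t, 0 <= t -> halfline_derivative F t (dF t)) /\
    {within [set t | 0 <= t], continuous dF}.

End MeanField.

(* Main.v *)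
Require Import Defs.
From HB Require Import structures.
From mathcomp Require Import all_boot all_order all_algebra.
From mathcomp Require Import all_classical all_reals all_analysis.
From mathcomp Require Import perm complex measurable_realfun ring lra.
Import Order.TTheory GRing.Theory Num.Theory.
Import numFieldNormedType.Exports.
Local Open Scope classical_set_scope.
Local Open Scope ring_scope.

(** Testing the weak equation against linear and quadratic polynomials gives
    m' = - C M m + C A^T G^-1 y and C' = - C M C with M = A^T G^-1 A.  Both
    C (C0^-1 + t M) - 1 and the difference between m and the claimed formula
    solve the linear equation X' = - C M X with X(0) = 0, hence vanish by
    Gronwall.  The operator C0 M is self-adjoint and nonnegative for the inner
    product of C0^-1, hence diagonalizable over the reals; if N denotes its
    group inverse S D^+ S^-1, then P = 1 - C0 M N is the projector onto ker A
    which is orthogonal for C0^-1.  With R(t) = (1 + t C0 M)^-1 one gets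
    C(t) = R(t) C0 and, since M w = A^T G^-1 eps for w = N C0 A^T G^-1 eps,
      m(t) = m0 + (1 - R(t)) (u + w - m0),
    where R(t) - P = O(1/t) is read off the eigenvalues.  The limit
    m0 + (1 - P) (u + w - m0) is the minimizer by Pythagoras. *)

Set Implicit Arguments.
Unset Strict Implicit.
Unset Printing Implicit Defensive.

(** * Self-adjoint operators over the reals *)

Lemma col_mulmx (R : pzRingType) (m n p : nat) (A : 'M[R]_(m, n)) (B : 'M[R]_(n, p)) j :
  col j (A *m B) = A *m col j B.
Proof. by apply/colP => i; rewrite !mxE; apply: eq_bigr => k _; rewrite mxE. Qed.

Lemma spd_form_ge0 (R : realType) (n p : nat) (H : 'M[R]_n) (X : 'M[R]_(n, p)) j :
  spd H -> 0 <= (X^T *m H *m X) j j.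
Proof.
move=> [_ Hpos]; have -> : (X^T *m H *m X) j j = ((col j X)^T *m H *m col j X) 0 0.
  by rewrite tr_col -row_mul -col_mulmx -row_mul [RHS]mxE [RHS]mxE.
have [->|X0] := eqVneq (col j X) 0; first by rewrite mulmx0 mxE.
exact/ltW/Hpos.
Qed.

(** Positive definiteness is applied column by column. Products such as [A *m P] are shown to vanish
    below through their weighted Gram matrix. *)
Lemma spd_form_eq0 (R : realType) (n p : nat) (H : 'M[R]_n) (X : 'M[R]_(n, p)) :
  spd H -> (forall j, (X^T *m H *m X) j j = 0) -> X = 0.
Proof.
move=> [_ Hpos] X0; apply/matrixP => i j.
have [/matrixP/(_ i 0)|/Hpos] := eqVneq (col j X) 0; first by rewrite !mxE.
by rewrite tr_col -row_mul -col_mulmx -row_mul 2!mxE X0 ltxx.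
Qed.

(** The polynomial has a root a + i b in the complex extension. If b = 0 this is a real root.
    Otherwise the remainder modulo the quadratic [q] has degree at most one and vanishes at a + i b:
    the imaginary part kills its slope, the real part its constant. *)
Lemma real_poly_factor (R : rcfType) (p : {poly R}) : (1 < size p)%N ->
  (exists a r, p = ('X - a%:P) * r) \/
  (exists a b r, b != 0 /\ p = (('X - a%:P) ^+ 2 + (b ^+ 2)%:P) * r).
Proof.
move=> sp; have /closed_rootP[z] : size (map_poly (real_complex R) p) != 1%N.
  by rewrite size_map_poly gtn_eqF.
case: z => a b pz; have [b0|b0] := eqVneq b 0.
  left; exists a; have /factor_theorem[r ->] : root p a.
    by move: pz; rewrite b0 complexr0 fmorph_root.
  by exists r; rewrite mulrC.
right; exists a, b; set q : {poly R} := _ + _.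
have sq : size q = 3%N.
  rewrite size_polyDl size_exp_XsubC// (leq_ltn_trans (size_polyC_leq1 _))//.
exists (divp p q); split => //.
have q0 : q != 0 by rewrite -size_poly_eq0 sq.
have sr : (size (modp p q) <= 2)%N by rewrite -ltnS -sq ltn_modp.
rewrite mulrC {1}(divp_eq p q); suff -> : modp p q = 0 by rewrite addr0.
set z := (a +i* b)%C in pz.
have qz : (map_poly (real_complex R) q).[z] = 0.
  rewrite /q rmorphD rmorphXn rmorphB/= map_polyX !map_polyC/= !hornerE/=.
  rewrite ?horner_exp ?hornerE /z.
  apply/eqP; rewrite eq_complex/=; simpc => /=.
  by rewrite andbT expr2 addNr.
have : (map_poly (real_complex R) (modp p q)).[z] = 0.
  move: pz; rewrite {1}(divp_eq p q) rmorphD rmorphM/= /root hornerD hornerM qz.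
  by rewrite mulr0 add0r => /eqP.
set r := modp p q in sr *.
have rE : r = (r`_1)%:P * 'X + (r`_0)%:P.
  apply/polyP => i; rewrite coefD coefCM coefX coefC.
  case: i => [|[|i]]/=; rewrite ?mulr0 ?mulr1 ?add0r ?addr0//.
  by rewrite nth_default// (leq_trans sr).
rewrite [in X in X -> _]rE rmorphD rmorphM/= map_polyX !map_polyC/= !hornerE /z.
move=> /eqP; rewrite eq_complex/=; simpc => /= /andP[/eqP h1 /eqP h2].
have r1 : r`_1 = 0 by apply/eqP; move/eqP: h2; rewrite mulf_eq0 (negbTE b0) orbF.
by move: h1; rewrite r1 mul0r add0r => r0; rewrite rE r1 r0 mul0r addr0.
Qed.

(* Any annihilating polynomial can be reduced to distinct real linear factors:
   self-adjointness gives ker (N - a)^2 = ker (N - a), and (N - a)^2 + b^2 is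
   injective for b <> 0. *)
Lemma selfadjoint_diagonalizable (R : realType) (n : nat) (H N : 'M[R]_n) :
  spd H -> (H *m N)^T = H *m N -> diagonalizable N.
Proof.
case: n H N => [|n] H N Hspd HN.
  by rewrite (flatmx0 N); exact: diagonalizable0.
have Hsym := Hspd.1.
have adj a : (N - a%:M)^T *m H = H *m (N - a%:M).
  move: HN; rewrite trmx_mul Hsym linearB/= tr_scalar_mx mulmxBl mulmxBr => ->.
  by rewrite scalar_mxC.
have sq a (X : 'M[R]_n.+1) : (N - a%:M) *m ((N - a%:M) *m X) = 0 ->
    (N - a%:M) *m X = 0.
  move=> X0; apply: (spd_form_eq0 Hspd) => j.
  by rewrite trmx_mul -(mulmxA X^T) adj -!mulmxA X0 !mulmx0 mxE.
have quad a (b : R) (X : 'M[R]_n.+1) : b != 0 ->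
    (N - a%:M) *m ((N - a%:M) *m X) + b ^+ 2 *: X = 0 -> X = 0.
  move=> b0 X0; apply: (spd_form_eq0 Hspd) => j.
  have /matrixP/(_ j j) : X^T *m H *m
      ((N - a%:M) *m ((N - a%:M) *m X) + b ^+ 2 *: X) = 0 by rewrite X0 mulmx0.
  set Y := (N - a%:M) *m X.
  have -> : X^T *m H *m ((N - a%:M) *m Y + b ^+ 2 *: X) =
      Y^T *m H *m Y + b ^+ 2 *: (X^T *m H *m X).
    rewrite mulmxDr -scalemxAr; congr (_ + _).
    by rewrite [in RHS]/Y trmx_mul -(mulmxA X^T _ H) adj !mulmxA.
  rewrite mxE [X in _ + X]mxE [X in _ = X]mxE => /eqP.
  have Y0 := spd_form_ge0 Y j Hspd; have XX0 := spd_form_ge0 X j Hspd.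
  rewrite (paddr_eq0 Y0 (mulr_ge0 (sqr_ge0 b) XX0)) => /andP[_].
  by rewrite mulf_eq0 sqrf_eq0 (negbTE b0) => /eqP.
(* Letting [X] vary allows a linear factor to be moved from [p] into [X], so that the induction on
   the size of [p] goes through. *)
suff key k (p : {poly R}) (X : 'M[R]_n.+1) : (size p <= k)%N -> p != 0 ->
    horner_mx N p *m X = 0 ->
    exists2 rs, uniq rs & horner_mx N (\prod_(x <- rs) ('X - x%:P)) *m X = 0.
  apply/diagonalizableP.
  have [||rs urs rs0] := key _ (mxminpoly N) 1%:M (leqnn _).
  - by rewrite -size_poly_gt0 size_mxminpoly.
  - by rewrite mx_root_minpoly mul0mx.
  by exists rs => //; apply: mxminpoly_min; rewrite mulmx1 in rs0.
have linE a : horner_mx N ('X - a%:P) = N - a%:M.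
  by rewrite rmorphB/= horner_mx_X horner_mx_C.
elim: k p X => [|k IH] p X; first by rewrite leqn0 size_poly_eq0 => ->.
move=> sp p0 pX; have [sp1|sp1] := leqP (size p) 1.
  exists [::] => //; rewrite big_nil rmorph1 mul1mx.
  move: pX; rewrite (size1_polyC sp1) horner_mx_C mul_scalar_mx => /eqP.
  rewrite scaler_eq0 => /orP[/eqP c0|/eqP//].
  by move: p0; rewrite (size1_polyC sp1) c0 eqxx.
have [[a [r pE]]|[a [b [r [b0 pE]]]]] := real_poly_factor sp1.
  have r0 : r != 0 by apply: contraNneq p0 => r0; rewrite pE r0 mulr0.
  have [||rs urs rs0] := IH r ((N - a%:M) *m X) _ r0.
  - by rewrite -ltnS (leq_trans _ sp)// pE size_monicM ?monicXsubC// size_XsubC.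
  - by rewrite -linE mulmxA mulmxE -rmorphM/= mulrC -pE.
  (* If [a] is already among the roots, the product contains (N - a)^2, which [sq] lowers to N - a;
     the list stays duplicate-free. *)
  have [ars|ars] := boolP (a \in rs); last first.
    exists (a :: rs); first by rewrite /= ars.
    by rewrite big_cons mulrC rmorphM/= -mulmxE -mulmxA linE.
  exists rs => //.
  have prodE : \prod_(x <- rs) ('X - x%:P) =
      ('X - a%:P) * \prod_(x <- rem a rs) ('X - x%:P) by rewrite (big_rem a).
  rewrite prodE rmorphM/= -mulmxE -mulmxA linE.
  apply: sq; rewrite -!linE !mulmxA !mulmxE -!rmorphM/= -mulrA.
  by rewrite -prodE mulrC rmorphM/= -!mulmxE -mulmxA linE.
have r0 : r != 0 by apply: contraNneq p0 => r0; rewrite pE r0 mulr0.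
apply: (IH r X _ r0).
  rewrite -ltnS (leq_trans _ sp)// pE.
  have sq3 : size (('X - a%:P) ^+ 2 + (b ^+ 2)%:P) = 3%N.
    by rewrite size_polyDl size_exp_XsubC// (leq_ltn_trans (size_polyC_leq1 _)).
  rewrite size_mul// -?size_poly_gt0 sq3//= -addn1 leq_add2r.
apply: (quad a b) => //.
rewrite -linE -mul_scalar_mx -(horner_mx_C N) !mulmxA -mulmxDl !mulmxE.
by rewrite -!rmorphM -rmorphD -mulrDl -expr2 -pE.
Qed.

(** An eigenvector x for d gives x^T H N x = d x^T H x, so every eigenvalue is nonnegative; sorting
    them in decreasing order puts the zeros last. *)
Lemma diagonalizable_psd (R : realType) (n : nat) (H N : 'M[R]_n) :
  spd H -> (H *m N)^T = H *m N ->
  (forall x : 'cV[R]_n, 0 <= (x^T *m (H *m N) *m x) 0 0) ->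
  exists (S : 'M[R]_n) (k : nat) (mu : nat -> R), is_diagonalization N S k mu.
Proof.
move=> Hspd HN Npos.
have [P Pu /diagonalizable_forPex[d /(simmxLR Pu) Nd]] :=
  selfadjoint_diagonalizable Hspd HN.
have PN : P *m N = diag_mx d *m P.
  by rewrite Nd mxpoly.conjVmx// !mulmxA mulmxV// mul1mx.
have d_ge0 i : 0 <= d 0 i.
  pose x := col i (invmx P).
  have Nx : N *m x = d 0 i *: x.
    rewrite -col_mulmx Nd mxpoly.conjVmx// mulmxK//.
    by apply/colP => a; rewrite mul_mx_diag !mxE mulrC.
  have x0 : x != 0.
    apply/eqP => x0; have : P *m x = 0 by rewrite x0 mulmx0.
    rewrite -col_mulmx mulmxV// => /colP/(_ i)/eqP.
    by rewrite !mxE eqxx oner_eq0.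
  have := Npos x; rewrite -mulmxA -mulmxA Nx -!scalemxAr mxE mulmxA.
  by rewrite pmulr_lge0// Hspd.2.
pose ds := [tuple d 0 i | i < n].
have /tuple_permP[s sE] : perm_eq (sort >=%O ds) ds by rewrite perm_sort.
pose mu := nth 0 (sort >=%O ds).
have muE (i : 'I_n) : mu i = d 0 (s i).
  by rewrite /mu sE -tnth_nth !tnth_mktuple.
have smu i j : (i <= j)%N -> (j < n)%N -> mu j <= mu i.
  move=> ij jn; have sz : size (sort >=%O ds) = n by rewrite size_sort size_tuple.
  have := @sorted_leq_nth _ >=%O (@ge_trans _ _) (@lexx _ _) 0 (sort >=%O ds).
  apply; rewrite ?inE ?sz ?(leq_ltn_trans ij)//.
  exact/sort_sorted/ge_total.
(* The first nonpositive entry of the decreasing list: all entries before it are positive, and all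
   from it on are zero because none is negative. *)
pose k := find (fun x => x <= 0) (sort >=%O ds).
have kn : (k <= n)%N.
  by rewrite /k (leq_trans (find_size _ _))// size_sort size_tuple.
have mu_pos i : (i < k)%N -> 0 < mu i.
  by move=> /(before_find 0)/negbT; rewrite -ltNge.
(* The rows of [P] are left eigenvectors of [N]; the permutation [s] lists them in the order of
   [mu]. *)
exists (invmx (row_perm s P)), k, mu.
have Pu' : row_perm s P \in unitmx by rewrite row_permE unitmx_mul unitmx_perm.
split=> //; first by rewrite unitmx_inv Pu'.
  by move=> i j ij jk; apply: smu => //; exact: leq_trans kn.
rewrite invmxK -mulmxA; apply: (canRL (mulKmx Pu')).
rewrite mul_diag_mx row_permE -mulmxA PN.
apply/matrixP => i j; rewrite -!row_permE mxE mul_diag_mx !mxE.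
case: ifPn => [_|]; first by rewrite -muE.
rewrite -leqNgt => ki; suff -> : d 0 (s i) = 0 by [].
apply/eqP; rewrite eq_le d_ge0 andbT -muE.
rewrite (le_trans (smu _ _ ki _))//.
have := @nth_find _ 0 (fun x => x <= 0) (sort >=%O ds); apply.
by rewrite has_find size_sort size_tuple (leq_ltn_trans ki).
Qed.

(** * Moments of polynomials of degree at most two *)

Section QuadraticPolynomials.
Context {R : realType} {n : nat}.
Implicit Types (Q : 'M[R]_n) (b u v : 'cV[R]_n) (c : R).

Definition quad Q b c u : R := (u^T *m Q *m u) 0 0 + (b^T *m u) 0 0 + c.

Lemma quadE Q b c u :
  quad Q b c u = \sum_i \sum_j Q i j * (u i 0 * u j 0) + \sum_i b i 0 * u i 0 + c.
Proof.
rewrite /quad [(b^T *m u) 0 0]mxE; congr (_ + _ + _).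
  rewrite -mulmxA mxE; apply: eq_bigr => i _; rewrite mxE mxE mulr_sumr.
  by apply: eq_bigr => j _; rewrite mulrCA mulrA.
by apply: eq_bigr => i _; rewrite mxE.
Qed.

(** The difference quotient is affine in the increment h: its value at h = 0 is the claimed
    derivative and its slope is the form of [Q] at [v]. *)
Lemma derive_quad Q b c u v :
  'D_v (quad Q b c) u = (((Q + Q^T) *m u + b)^T *m v) 0 0.
Proof.
set l := RHS.
have bE : (b^T *m v) 0 0 = l - (u^T *m Q *m v) 0 0 - (v^T *m Q *m u) 0 0.
  have -> : (v^T *m Q *m u) 0 0 = (u^T *m Q^T *m v) 0 0.
    by rewrite -[in LHS](trmxK (v^T *m _ *m _)) mxE !trmx_mul trmxK mulmxA.
  rewrite /l linearD/= trmx_mul linearD/= trmxK mulmxDl mulmxDr mulmxDl !mxE.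
  by ring.
apply: cvg_lim => //; apply: (@cvg_trans _
    ((fun h : R => l + h * (v^T *m Q *m v) 0 0) @ 0^')); last first.
  have : (fun h : R => l + h * (v^T *m Q *m v) 0 0) @ 0^' -->
      l + 0 * (v^T *m Q *m v) 0 0.
    apply: cvgD; first exact: cvg_cst.
    by apply: cvgMr_tmp; apply: cvg_within_filter; exact: cvg_id.
  by rewrite mul0r addr0.
apply: near_eq_cvg; near=> h.
have h0 : h != 0 by near: h; exact: nbhs_dnbhs_neq.
have -> : (quad Q b c \o shift u) (h *: v) = quad Q b c (h *: v + u) by [].
have -> : quad Q b c (h *: v + u) = h ^+ 2 * (v^T *m Q *m v) 0 0 +
    h * (v^T *m Q *m u) 0 0 + h * (u^T *m Q *m v) 0 0 + (u^T *m Q *m u) 0 0 +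
    (h * (b^T *m v) 0 0 + (b^T *m u) 0 0) + c.
  have trE : (h *: v + u)^T = h *: v^T + u^T by rewrite linearD/= linearZ.
  rewrite /quad trE !(mulmxDl, mulmxDr) -!scalemxAl -!scalemxAr.
  by rewrite !mxE; ring.
rewrite bE /quad /GRing.scale/=; field.
exact: h0.
Unshelve. all: by end_near. Qed.

Lemma grad_quad Q b c u : grad (quad Q b c) u = (Q + Q^T) *m u + b.
Proof.
apply/colP => i; rewrite mxE derive_quad -colE.
by rewrite 2!mxE.
Qed.

Lemma hess_quad Q b c u : hess (quad Q b c) u = Q + Q^T.
Proof.
apply/matrixP => i j; rewrite mxE.
(* A first partial derivative is again of the shape [quad], with no quadratic part, so [derive_quad]
   applies a second time. *)
have -> : (fun w => 'D_(delta_mx i 0) (quad Q b c) w) =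
    quad 0 (row i (Q + Q^T))^T (b i 0).
  apply/funext => w; have := congr1 (fun x : 'cV[R]_n => x i 0) (grad_quad Q b c w).
  rewrite mxE => ->; rewrite /quad mulmx0 mul0mx trmxK -row_mul !mxE.
  by rewrite add0r.
by rewrite derive_quad trmx0 addr0 mul0mx add0r trmxK -colE !mxE.
Qed.

End QuadraticPolynomials.

Section RealIntegrals.
Context d (T : measurableType d) (R : realType) (P : probability T R).

Lemma Rintegral_probability_cst (c : R) : \int[P]_x c = c.
Proof. by rewrite Rintegral_cst// [X in fine X](probability_setT P) mulr1. Qed.

Lemma Rintegral_sum (I : Type) (s : seq I) (f : I -> T -> R) :
  (forall i, P.-integrable setT (EFin \o f i)) ->
  P.-integrable setT (EFin \o (fun x => \sum_(i <- s) f i x)) /\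
  \int[P]_x (\sum_(i <- s) f i x) = \sum_(i <- s) \int[P]_x f i x.
Proof.
move=> fi; elim: s => [|i s [IH1 IH2]].
  rewrite big_nil; under eq_fun do rewrite big_nil.
  split; first exact: finite_measure_integrable_cst.
  exact: Rintegral_probability_cst.
have sE : (fun x => \sum_(k <- i :: s) f k x) =
    (fun x => f i x + \sum_(k <- s) f k x).
  by apply/funext => x; rewrite big_cons.
rewrite sE; split; first exact: (integrableD measurableT (fi i) IH1).
by rewrite big_cons RintegralD// IH2.
Qed.

End RealIntegrals.

Section Moments.
Context {R : realType} {n : nat}.
Implicit Types (P : probability (borel_cV R n) R).

Lemma continuous_borel_measurable (f : 'cV[R]_n -> R) : continuous f ->
  measurable_fun setT (f : borel_cV R n -> R).
Proof.
move=> /continuousP fc.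
apply: (measurability _ (RGenOpens.measurableE R)).
move=> _ [_ [a [b ->]] <-]; rewrite setTI.
by apply: sub_sigma_algebra; apply: fc; exact: interval_open.
Qed.

Definition second_moment P : 'M[R]_n :=
  \matrix_(i, j) \int[P]_u ((u : 'cV[R]_n) i 0 * (u : 'cV[R]_n) j 0).


Lemma sqr_coord_le (u : 'cV[R]_n) i : u i 0 ^+ 2 <= (u^T *m u) 0 0.
Proof.
rewrite mxE (bigD1 i)//= mxE -expr2 lerDl sumr_ge0// => k _.
by rewrite mxE -expr2 sqr_ge0.
Qed.

Lemma measurable_coord i :
  measurable_fun setT (fun u : borel_cV R n => (u : 'cV[R]_n) i 0).
Proof. by apply: continuous_borel_measurable; exact: coord_continuous. Qed.

Lemma integrable_sqr_norm P : finite_second_moment P ->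
  P.-integrable setT (EFin \o fun u => ((u : 'cV[R]_n)^T *m u) 0 0).
Proof.
move=> Pfin; apply/integrableP; split.
  apply/measurable_EFinP.
  rewrite (_ : (fun u => _) = fun u : borel_cV R n =>
    \sum_(k <- index_enum 'I_n) (u : 'cV[R]_n) k 0 * (u : 'cV[R]_n) k 0).
    apply: measurable_sum => k; apply: measurable_funM; exact: measurable_coord.
  by apply/funext => u; rewrite mxE; apply: eq_bigr => k _; rewrite mxE.
under eq_integral => u _.
  rewrite /= ger0_norm; last first.
    by rewrite mxE sumr_ge0// => k _; rewrite mxE -expr2 sqr_ge0.
  over.
exact: Pfin.
Qed.

(** Domination by the squared norm: |u_i u_j| <= (u_i^2 + u_j^2) / 2 <= u^T u. *)
Lemma integrable_coordM P i j : finite_second_moment P ->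
  P.-integrable setT
    (EFin \o fun u => (u : 'cV[R]_n) i 0 * (u : 'cV[R]_n) j 0).
Proof.
move=> Pfin; apply: le_integrable (integrable_sqr_norm Pfin) => //.
  by apply/measurable_EFinP; apply: measurable_funM; exact: measurable_coord.
move=> u _; rewrite /= lee_fin.
have hi := sqr_coord_le u i; have hj := sqr_coord_le u j.
rewrite [leRHS]ger0_norm ?(le_trans (sqr_ge0 _) hi)//.
by rewrite ler_norml; apply/andP; split; nra.
Qed.

(** Domination by an integrable function: |u_i| <= 1 + u_i^2 <= 1 + u^T u. *)
Lemma integrable_coord P i : finite_second_moment P ->
  P.-integrable setT (EFin \o fun u => (u : 'cV[R]_n) i 0).
Proof.
move=> Pfin.
have : P.-integrable setT (EFin \o fun u => 1 + ((u : 'cV[R]_n)^T *m u) 0 0).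
  have i1 : P.-integrable setT (EFin \o (cst 1 : borel_cV R n -> R)).
    exact: finite_measure_integrable_cst.
  exact: (integrableD measurableT i1 (integrable_sqr_norm Pfin)).
apply: le_integrable => //.
  by apply/measurable_EFinP; exact: measurable_coord.
move=> u _; rewrite /= lee_fin.
have hi := sqr_coord_le u i.
rewrite [leRHS]ger0_norm ?addr_ge0// ?(le_trans (sqr_ge0 _) hi)//.
by rewrite ler_norml; apply/andP; split; nra.
Qed.

(** This turns every integral in the weak equation into an expression in the first two moments. The
    trace is the sum of the products Q_ij S_ij. *)
Lemma integrable_quad P Q b c : finite_second_moment P ->
  P.-integrable setT (EFin \o (quad Q b c : borel_cV R n -> R)) /\
  \int[P]_u quad Q b c u = \tr (Q^T *m second_moment P) +
    (b^T *m mean P) 0 0 + c.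
Proof.
move=> Pfin.
have iZ (k : R) (f : borel_cV R n -> R) : P.-integrable setT (EFin \o f) ->
    P.-integrable setT (EFin \o (fun u => k * f u)).
  by move=> fi; exact: (integrableZl measurableT k fi).
have iQ2 i j := iZ (Q i j) _ (integrable_coordM i j Pfin).
have iQ1 i := Rintegral_sum (index_enum 'I_n) (iQ2 i).
have [iQ EQ] := Rintegral_sum (index_enum 'I_n) (fun i => (iQ1 i).1).
have [ib Eb] := Rintegral_sum (index_enum 'I_n)
  (fun i => iZ (b i 0) _ (integrable_coord i Pfin)).
have ic : P.-integrable setT (EFin \o (cst c : borel_cV R n -> R)).
  exact: finite_measure_integrable_cst.
have iQb := integrableD measurableT iQ ib.
have -> : (quad Q b c : borel_cV R n -> R) = fun u =>
    \sum_i \sum_j Q i j * ((u : 'cV[R]_n) i 0 * (u : 'cV[R]_n) j 0) +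
    \sum_i b i 0 * (u : 'cV[R]_n) i 0 + c.
  by apply/funext => u; rewrite quadE.
split; first exact: (integrableD measurableT iQb ic).
rewrite (RintegralD measurableT iQb ic) (RintegralD measurableT iQ ib) EQ Eb.
rewrite Rintegral_probability_cst; congr (_ + _ + _).
  under eq_bigr do rewrite (iQ1 _).2.
  rewrite exchange_big; apply: eq_bigr => j _; rewrite mxE; apply: eq_bigr => i _.
  by rewrite !mxE RintegralZl//; exact: integrable_coordM.
rewrite mxE; apply: eq_bigr => i _.
by rewrite !mxE RintegralZl//; exact: integrable_coord.
Qed.


Lemma trace_delta_mul (i j : 'I_n) (X : 'M[R]_n) : \tr (delta_mx i j *m X) = X j i.
Proof.
rewrite /mxtrace (bigD1 i)//= big1 ?addr0 => [|k ki]; rewrite mxE.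
  rewrite (bigD1 j)//= big1 ?addr0 => [|l lj]; rewrite mxE ?eqxx ?mul1r//.
  by rewrite (negbTE lj) andbF mul0r.
by rewrite big1// => l _; rewrite mxE (negbTE ki) mul0r.
Qed.

Lemma delta_mx_dot (i : 'I_n) (u : 'cV[R]_n) :
  ((delta_mx i 0 : 'cV[R]_n)^T *m u) 0 0 = u i 0.
Proof. by rewrite trmx_delta -rowE mxE. Qed.

Lemma delta_mx_form (i j : 'I_n) (u v : 'cV[R]_n) :
  (u^T *m delta_mx i j *m v) 0 0 = u i 0 * v j 0.
Proof.
rewrite -(mul_delta_mx (0 : 'I_1)) mulmxA -colE -mulmxA -rowE.
by rewrite mxE big_ord1 !mxE.
Qed.

Lemma cov_sym P : (cov P)^T = cov P.
Proof.
apply/matrixP => i j; rewrite !mxE; apply: eq_Rintegral => u _.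
by rewrite !mxE; apply: eq_bigr => k _; rewrite !mxE mulrC.
Qed.

Lemma second_momentE P : finite_second_moment P ->
  second_moment P = cov P + mean P *m (mean P)^T.
Proof.
move=> Pfin; apply/matrixP => i j; rewrite [in RHS]mxE [(_ *m _) i j]mxE big_ord1.
rewrite [_^T _ _]mxE [cov P i j]mxE.
set m := mean P.
(* The linear part of (u_i - m_i) (u_j - m_j); the constant part is m_i m_j. *)
pose b := - (m j 0 *: delta_mx i 0 + m i 0 *: delta_mx j 0) : 'cV[R]_n.
have bE (w : 'cV[R]_n) : (b^T *m w) 0 0 = - (m j 0 * w i 0 + m i 0 * w j 0).
  have -> : b^T = - (m j 0 *: (delta_mx i 0 : 'cV[R]_n)^T +
      m i 0 *: (delta_mx j 0 : 'cV[R]_n)^T).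
    by rewrite /b linearN linearD/= !linearZ.
  rewrite mulNmx mulmxDl -!scalemxAl [LHS]mxE; congr (- _); rewrite [LHS]mxE.
  by congr (_ + _); rewrite mxE delta_mx_dot.
have -> : \int[P]_u ((((u : 'cV[R]_n) - m) *m ((u : 'cV[R]_n) - m)^T) i j) =
    \int[P]_u quad (delta_mx i j) b (m i 0 * m j 0) u.
  apply: eq_Rintegral => u _; rewrite /quad delta_mx_form bE.
  by rewrite mxE big_ord1 !mxE; ring.
rewrite (integrable_quad _ _ _ Pfin).2 trmx_delta trace_delta_mul -/m bE.
by ring.
Qed.

End Moments.

(** * Differential equations on the closed half-line *)

Section HalflineCalculus.
Context {R : realType}.
Implicit Types (F dF : R -> R) (t : R).

(* Two-sided derivatives at t > 0 and continuity up to 0 are all that Gronwall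
   needs; nothing is asked of F at negative times. *)
Definition halfline_diff F dF : Prop :=
  (forall t, 0 < t -> is_derive t 1 F (dF t)) /\
  {within [set t | 0 <= t], continuous F}.

Lemma halfline_derivative_diff F dF :
  (forall t, 0 <= t -> halfline_derivative F t (dF t)) -> halfline_diff F dF.
Proof.
move=> FdF; split=> [t t0|].
  have := FdF t (ltW t0); rewrite /halfline_derivative => h.
  suff h' : (fun h => h^-1 *: ((F \o shift t) (h *: (1 : R)) - F t)) @ 0^' --> dF t.
    apply: DeriveDef; first by apply/cvg_ex; exists (dF t).
    exact: cvg_lim h'.
  apply/cvgrPdist_lt => e e0; move/cvgrPdist_lt: h => /(_ e e0) [d /= d0 hd].
  (* An increment smaller than t in absolute value keeps h + t in the half-line, where the given
     quotient is controlled. *)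
  exists (Num.min d t) => /=; first by rewrite lt_min d0 t0.
  move=> h /=; rewrite sub0r normrN lt_min => /andP[hd1 hd2] h0.
  have th : t - (h + t) = - h by ring.
  have := hd (h + t); rewrite /= th normrN addrK.
  move=> /(_ hd1); rewrite /GRing.scale/= mulr1 [_ / h]mulrC; apply.
    by rewrite -subr_eq0 addrK.
  by move: hd2; rewrite ltr_norml => /andP[+ _]; lra.
apply/subspace_continuousP => t t0.
(* Tolerance 1 bounds the quotient by |dF t| + 1 near t, a local Lipschitz estimate at t that yields
   continuity there, also at t = 0. *)
have /cvgrPdist_lt /(_ 1 ltr01)[d /= d0 hd] := FdF t t0.
apply/cvgrPdist_lt => e e0.
have k0 : 0 < `|dF t| + 1 by rewrite ltr_wpDl.
exists (Num.min d (e / (`|dF t| + 1))) => /=.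
  by rewrite lt_min d0 divr_gt0.
move=> s /=; rewrite lt_min => /andP[sd se] s0.
have [->|st] := eqVneq s t; first by rewrite subrr normr0.
have /= q1 := hd s sd st s0.
have st0 : s - t != 0 by rewrite subr_eq0.
have q2 : `|(F s - F t) / (s - t)| < `|dF t| + 1.
  rewrite -ltrBlDl (le_lt_trans _ q1)// -[leRHS]normrN opprB.
  exact: lerB_dist.
rewrite -[ltLHS]normrN opprB -[X in `|X|](divfK st0) normrM.
rewrite (le_lt_trans (ler_wpM2r (normr_ge0 _) (ltW q2)))//.
by rewrite mulrC -ltr_pdivlMr// -normrN opprB.
Qed.

Lemma halfline_diff_cst (k : R) : halfline_diff (fun=> k) (fun=> 0).
Proof. by split=> [t _|]; [exact: is_derive_cst | move=> ?; exact: cvg_cst]. Qed.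

Lemma halfline_diff_id : halfline_diff id (fun=> 1).
Proof.
split=> [t _|]; first exact: is_derive_id.
by apply/subspace_continuousP => t _; apply: cvg_within.
Qed.

Lemma halfline_diffD F dF G dG : halfline_diff F dF -> halfline_diff G dG ->
  halfline_diff (fun t => F t + G t) (fun t => dF t + dG t).
Proof.
move=> [F1 F2] [G1 G2]; split=> [t t0|t].
  by have ? := F1 t t0; have ? := G1 t t0; exact: is_deriveD.
by apply: cvgD; [exact: F2 | exact: G2].
Qed.

Lemma halfline_diffM F dF G dG : halfline_diff F dF -> halfline_diff G dG ->
  halfline_diff (fun t => F t * G t) (fun t => dF t * G t + F t * dG t).
Proof.
move=> [F1 F2] [G1 G2]; split=> [t t0|t].
  have ? := F1 t t0; have ? := G1 t t0.
  by apply: is_derive_eq; rewrite addrC /GRing.scale/= [in X in X + _]mulrC.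
by apply: cvgM; [exact: F2 | exact: G2].
Qed.

Lemma halfline_diff_sum (I : Type) (s : seq I) (F dF : I -> R -> R) :
  (forall i, halfline_diff (F i) (dF i)) ->
  halfline_diff (fun t => \sum_(i <- s) F i t) (fun t => \sum_(i <- s) dF i t).
Proof.
move=> FdF; elim: s => [|i s IH].
  under eq_fun do rewrite big_nil; under [X in halfline_diff _ X]eq_fun do rewrite big_nil.
  exact: halfline_diff_cst.
under eq_fun do rewrite big_cons; under [X in halfline_diff _ X]eq_fun do rewrite big_cons.
exact: halfline_diffD.
Qed.

Definition halfline_diffmx (m n : nat) (X dX : R -> 'M[R]_(m, n)) : Prop :=
  forall i j, halfline_diff (fun t => X t i j) (fun t => dX t i j).


(** Equality for t >= 0 suffices: a positive t has a neighbourhood inside the half-line, and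
    continuity is only relative to the half-line. *)
Lemma eq_halfline_diff F dF F' dF' : halfline_diff F dF ->
  (forall t, 0 <= t -> F t = F' t) -> (forall t, 0 <= t -> dF t = dF' t) ->
  halfline_diff F' dF'.
Proof.
move=> [F1 F2] FF' dFF'; split=> [t t0|].
  have := F1 t t0; rewrite (dFF' _ (ltW t0)).
  have e : \near t, F t = F' t.
    by near=> s; apply/FF'/ltW; near: s; exact: lt_nbhsr.
  exact: (near_eq_is_derive e).
apply/subspace_continuousP => t t0.
suff : F' @ within [set t | 0 <= t] (nbhs t) --> F t by rewrite (FF' t t0).
move/subspace_continuousP : F2 => /(_ t t0); apply: cvg_trans.
apply: near_eq_cvg; near=> s; apply: FF'; near: s; exact: near_withinT.
Unshelve. all: by end_near. Qed.

Lemma eq_halfline_diffmx (m n : nat) (X dX X' dX' : R -> 'M[R]_(m, n)) :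
  halfline_diffmx X dX ->
  (forall t, 0 <= t -> X t = X' t) -> (forall t, 0 <= t -> dX t = dX' t) ->
  halfline_diffmx X' dX'.
Proof.
move=> XdX XX' dXX' i j; apply: (eq_halfline_diff (XdX i j)) => t t0.
  by rewrite XX'.
by rewrite dXX'.
Qed.

Lemma halfline_diffmx_cst (m n : nat) (K : 'M[R]_(m, n)) :
  halfline_diffmx (fun=> K) (fun=> 0).
Proof.
move=> i j; under [X in halfline_diff _ X]eq_fun do rewrite mxE.
exact: halfline_diff_cst.
Qed.

Lemma halfline_diffmxD (m n : nat) (X dX Y dY : R -> 'M[R]_(m, n)) :
  halfline_diffmx X dX -> halfline_diffmx Y dY ->
  halfline_diffmx (fun t => X t + Y t) (fun t => dX t + dY t).
Proof.
move=> XdX YdY i j; under eq_fun do rewrite mxE.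
under [X in halfline_diff _ X]eq_fun do rewrite mxE.
exact: halfline_diffD.
Qed.

Lemma halfline_diffmxB (m n : nat) (X dX Y dY : R -> 'M[R]_(m, n)) :
  halfline_diffmx X dX -> halfline_diffmx Y dY ->
  halfline_diffmx (fun t => X t - Y t) (fun t => dX t - dY t).
Proof.
move=> XdX YdY i j; have [X1 X2] := XdX i j; have [Y1 Y2] := YdY i j.
under eq_fun do rewrite !mxE; under [X in halfline_diff _ X]eq_fun do rewrite !mxE.
split=> [t t0|t].
  by have ? := X1 t t0; have ? := Y1 t t0; exact: is_deriveB.
by apply: cvgB; [exact: X2 | exact: Y2].
Qed.

Lemma halfline_diffmxM (m n p : nat) (X dX : R -> 'M[R]_(m, n))
    (Y dY : R -> 'M[R]_(n, p)) :
  halfline_diffmx X dX -> halfline_diffmx Y dY ->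
  halfline_diffmx (fun t => X t *m Y t) (fun t => dX t *m Y t + X t *m dY t).
Proof.
move=> XdX YdY i j; under eq_fun do rewrite mxE.
under [X in halfline_diff _ X]eq_fun do rewrite !mxE -big_split.
by apply: halfline_diff_sum => k; exact: halfline_diffM.
Qed.

Lemma halfline_diffmxZ (m n : nat) F dF (X dX : R -> 'M[R]_(m, n)) :
  halfline_diff F dF -> halfline_diffmx X dX ->
  halfline_diffmx (fun t => F t *: X t) (fun t => dF t *: X t + F t *: dX t).
Proof.
move=> FdF XdX i j; under eq_fun do rewrite mxE.
under [X in halfline_diff _ X]eq_fun do rewrite !mxE.
exact: halfline_diffM.
Qed.

Lemma halfline_diff_trmx (m n : nat) (X dX : R -> 'M[R]_(m, n)) :
  halfline_diffmx X dX -> halfline_diffmx (fun t => (X t)^T) (fun t => (dX t)^T).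
Proof.
move=> XdX i j; under eq_fun do rewrite mxE.
under [X in halfline_diff _ X]eq_fun do rewrite mxE.
exact: XdX.
Qed.

End HalflineCalculus.

(** * Uniqueness for linear differential equations *)

Section LinearODE.
Context {R : realType}.

Lemma continuous_within_sum (A : set R) (I : Type) (s : seq I) (F : I -> R -> R) :
  (forall i, {within A, continuous (F i)}) ->
  {within A, continuous (fun t => \sum_(i <- s) F i t)}.
Proof.
move=> Fc; elim: s => [|i s IH].
  by under eq_fun do rewrite big_nil; move=> t; exact: cvg_cst.
by under eq_fun do rewrite big_cons; move=> t; apply: cvgD; [exact: Fc | exact: IH].
Qed.

(** Gronwall for the squared Frobenius norm [f] of [X] on each interval [0, T], where the continuous
    coefficient [N] is bounded. *)
Lemma linear_ode_zero (n p : nat) (N : R -> 'M[R]_n) (X : R -> 'M[R]_(n, p)) :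
  (forall i j, {within [set t | 0 <= t], continuous (fun t => N t i j)}) ->
  halfline_diffmx X (fun t => N t *m X t) -> X 0 = 0 ->
  forall t : R, 0 <= t -> X t = 0.
Proof.
move=> Nc XdX X0 T; rewrite le_eqVlt => /predU1P[<-//|T0].
have sub0T : `[0, T]%classic `<=` [set t : R | 0 <= t].
  by move=> t /=; rewrite in_itv/= => /andP[].
have [K NK] : exists K : R, forall t : R, t \in `[0, T] -> forall i j, `|N t i j| <= K.
  (* The sum of all absolute entries is continuous and dominates each entry, so its maximum on
     [0, T] is a uniform bound. *)
  pose kappa (t : R) : R := \sum_i \sum_j `|N t i j|.
  have kc : {within `[0, T], continuous kappa}.
    apply: (continuous_subspaceW sub0T).
    apply: continuous_within_sum => i; apply: continuous_within_sum => j t.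
    by apply: cvg_norm; exact: Nc.
  have [c _ kmax] := EVT_max (ltW T0) kc.
  exists (kappa c) => t tT i j; apply: le_trans (kmax t tT).
  rewrite /kappa (bigD1 i)//= (bigD1 j)//= -addrA lerDl addr_ge0//.
    by apply: sumr_ge0.
  by apply: sumr_ge0 => k _; apply: sumr_ge0.
pose f t := \sum_i \sum_j X t i j * X t i j.
pose df t := \sum_i \sum_j
  ((N t *m X t) i j * X t i j + X t i j * (N t *m X t) i j).
have fdf : halfline_diff f df.
  by apply: halfline_diff_sum => i; apply: halfline_diff_sum => j; exact: halfline_diffM.
pose L : R := 2 * K * n%:R.
have df_le (t : R) : t \in `[0, T] -> df t <= L * f t.
  move=> tT.
  (* With a = X_ij and b = X_kj, add (K - N_ik) (a + b)^2 >= 0 and (K + N_ik) (a - b)^2 >= 0.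
     Summing over the n values of the free index gives the constant L = 2 K n. *)
  have term i j k : 2 * (X t i j * (N t i k * X t k j)) <=
      K * (X t i j * X t i j) + K * (X t k j * X t k j).
    have := NK t tT i k; rewrite ler_norml => /andP[K1 K2].
    have := mulr_ge0 (_ : 0 <= K - N t i k) (sqr_ge0 (X t i j + X t k j)).
    have := mulr_ge0 (_ : 0 <= K + N t i k) (sqr_ge0 (X t i j - X t k j)).
    by rewrite !expr2; lra.
  have -> : df t = \sum_i \sum_j \sum_k 2 * (X t i j * (N t i k * X t k j)).
    apply: eq_bigr => i _; apply: eq_bigr => j _.
    by rewrite [X in X + _]mulrC -mulr2n -[LHS]mulr_natl mxE !mulr_sumr.
  have -> : L * f t = \sum_i \sum_j \sum_(k < n)
      (K * (X t i j * X t i j) + K * (X t k j * X t k j)).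
    have -> : L * f t = K * f t *+ n + K * f t *+ n.
      by rewrite -mulrnDr addnn -muln2 mulrnA -2!mulr_natr /L; ring.
    under [in RHS]eq_bigr do under eq_bigr do rewrite big_split/= sumr_const card_ord.
    under [in RHS]eq_bigr do rewrite big_split/=.
    rewrite big_split/=; congr (_ + _).
      rewrite /f mulr_sumr -sumrMnl; apply: eq_bigr => i _.
      by rewrite mulr_sumr -sumrMnl.
    under [in RHS]eq_bigr do rewrite exchange_big/=.
    rewrite sumr_const card_ord; congr (_ *+ _).
    by rewrite /f mulr_sumr; apply: eq_bigr => i _; rewrite mulr_sumr.
  by apply: ler_sum => i _; apply: ler_sum => j _; apply: ler_sum => k _.
(* Gronwall: f' <= L f makes f * exp (- L t) nonincreasing. *)
pose e (t : R) : R := expR (- (L * t)).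
have ede : halfline_diff e (fun t => - L * e t).
  have ed (t : R) : is_derive t 1 e (- L * e t).
    have -> : e = expR \o *%R (- L) by apply/funext => s; rewrite /e /= mulNr.
    have Ld : is_derive t 1 ( *%R (- L)) (- L).
      by apply: is_derive_eq; rewrite /GRing.scale/= mulr1.
    apply: DeriveDef.
      apply/derivable1_diffP/differentiable_comp; apply/derivable1_diffP.
        by case: Ld.
      exact: derivable_expR.
    rewrite -derive1E derive1_comp ?derive1E; [|by case: Ld|exact: derivable_expR].
    by have [_ ->] := Ld; have [_ ->] := is_derive_expR (- L * t); rewrite mulrC.
  split=> [t _|]; first exact: ed.
  apply: continuous_subspaceT => t; apply/differentiable_continuous.
  by apply/derivable1_diffP; case: (ed t).
have [gd gc] := halfline_diffM fdf ede.
have : f T * e T <= f 0 * e 0.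
  apply: (@ler0_derive1_le_cc _ (fun t => f t * e t) 0 T).
  - by move=> t; rewrite in_itv/= => /andP[t0 _]; have [] := gd t t0.
  - move=> t tT; have := tT; rewrite in_itv/= => /andP[t0 _].
    rewrite derive1E; have [_ ->] := gd t t0.
    have := df_le t (subset_itv_oo_cc tT); have := expR_gt0 (- (L * t)).
    rewrite -/(e t); nra.
  - exact: continuous_subspaceW gc.
  - by rewrite in_itv/= lexx ltW.
  - by rewrite in_itv/= lexx ltW.
  - exact: ltW.
have -> : f 0 = 0.
  by rewrite /f X0 big1// => i _; rewrite big1// => j _; rewrite mxE mul0r.
rewrite mul0r pmulr_lle0 ?expR_gt0// => fT.
have f_ge0 i : 0 <= \sum_j X T i j * X T i j.
  by apply: sumr_ge0 => j _; rewrite -expr2 sqr_ge0.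
have : f T == 0 by rewrite eq_le fT sumr_ge0.
rewrite psumr_eq0// => /allP fi0; apply/matrixP => i j; rewrite mxE.
have := fi0 i (mem_index_enum _); rewrite /= psumr_eq0; last first.
  by move=> k _; rewrite -expr2 sqr_ge0.
by move=> /allP/(_ j (mem_index_enum _)); rewrite /= mulf_eq0 orbb => /eqP.
Qed.

End LinearODE.

(** * The mean-field equations *)

Section MomentEquations.
Context {R : realType} {m n : nat}.
Variables (A : 'M[R]_(m, n)) (G : 'M[R]_m) (y : 'cV[R]_m).

Let M : 'M[R]_n := A^T *m invmx G *m A.
Let beta : 'cV[R]_n := A^T *m invmx G *m y.

(** For a fixed matrix [C] the generator preserves polynomials of degree at most two; hence the
    first two moments satisfy a closed system. *)
Lemma eki_generator_quad (C Q : 'M[R]_n) (b : 'cV[R]_n) (c : R) (u : 'cV[R]_n) :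
  eki_generator A G y C (quad Q b c) u =
  quad (- ((Q + Q^T) *m (C *m M)))
       ((Q + Q^T) *m (C *m beta) - (C *m M)^T *m b)
       ((b^T *m (C *m beta)) 0 0 + 2^-1 * \tr ((Q + Q^T) *m (C *m M *m C))) u.
Proof.
rewrite /eki_generator grad_quad hess_quad /quad.
set T := Q + Q^T.
have Tsym : T^T = T by rewrite /T linearD/= trmxK addrC.
clearbody T.
have -> : C *m A^T *m invmx G *m (A *m u - y) = C *m M *m u - C *m beta.
  by rewrite /M /beta mulmxBr !mulmxA.
have -> : C *m A^T *m invmx G *m A *m C = C *m M *m C by rewrite /M !mulmxA.
have -> : (T *m u + b)^T = u^T *m T + b^T by rewrite linearD/= trmx_mul Tsym.
have -> : (T *m (C *m beta) - (C *m M)^T *m b)^T =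
    (C *m beta)^T *m T - b^T *m (C *m M).
  by rewrite linearB/=; congr (_ - _); rewrite trmx_mul ?trmxK ?Tsym.
have e v : (v^T *m T *m u) 0 0 = (u^T *m T *m v) 0 0.
  by rewrite -[in LHS](trmxK (v^T *m T *m u)) mxE !trmx_mul trmxK Tsym mulmxA.
have addE (X Y : 'M[R]_1) : (X + Y) 0 0 = X 0 0 + Y 0 0 by rewrite mxE.
have oppE (X : 'M[R]_1) : (- X) 0 0 = - X 0 0 by rewrite mxE.
rewrite mulmxBr !mulmxDl mulmxN !mulNmx !(addE, oppE) e !mulmxA.
by ring.
Qed.

Lemma degree_le2_quad (Q : 'M[R]_n) (b : 'cV[R]_n) (c : R) :
  degree_le2 (quad Q b c).
Proof. by exists Q, b, c. Qed.

Variable rho : R -> probability (borel_cV R n) R.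
Hypothesis rho_sol : mean_field_eki A G y rho.

Let mt t := mean (rho t).
Let Ct t := cov (rho t).

Lemma mean_ode :
  halfline_diffmx mt (fun t => - (Ct t *m M *m mt t) + Ct t *m beta).
Proof.
have [fin sol] := rho_sol => i j; rewrite ord1 {j}.
apply: halfline_derivative_diff => t t0.
have [+ _] := sol _ (degree_le2_quad 0 (delta_mx i 0) 0).
move=> /(_ t t0); congr halfline_derivative.
  apply/funext => s; rewrite /mt mxE; apply: eq_Rintegral => u _.
  by rewrite /quad mulmx0 mul0mx delta_mx_dot mxE add0r addr0.
under eq_Rintegral do rewrite eki_generator_quad.
rewrite (integrable_quad _ _ _ (fin t t0)).2 -/(mt t) -/(Ct t).
rewrite trmx0 addr0 !mul0mx mxtrace0 mulr0 oppr0 trmx0 mul0mx mxtrace0 !add0r addr0.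
rewrite delta_mx_dot [RHS]mxE; congr (_ + _).

rewrite linearN/= trmx_mul trmxK mulNmx [LHS]mxE [RHS]mxE -[in LHS]mulmxA; congr (- _).
by rewrite delta_mx_dot.
Qed.

Hypothesis G_sym : G^T = G.

Lemma gram_sym : M^T = M.
Proof. by rewrite /M !trmx_mul trmxK trmx_inv G_sym mulmxA. Qed.

(** The test polynomial is u_i u_j. Test polynomials do not depend on time while the covariance is
    centred at the moving mean, so raw second moments come first. *)
Lemma second_moment_ode :
  halfline_diffmx (fun t => second_moment (rho t)) (fun t =>
    let S := second_moment (rho t) in
    - (S *m M *m Ct t) - Ct t *m M *m S
    + mt t *m (Ct t *m beta)^T + Ct t *m beta *m (mt t)^T + Ct t *m M *m Ct t).
Proof.
have [fin sol] := rho_sol => i j.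
apply: halfline_derivative_diff => t t0.
have [+ _] := sol _ (degree_le2_quad (delta_mx i j) 0 0).
move=> /(_ t t0); congr halfline_derivative.
  apply/funext => s; rewrite mxE; apply: eq_Rintegral => u _.
  by rewrite /quad delta_mx_form trmx0 mul0mx mxE !addr0.
under eq_Rintegral do rewrite eki_generator_quad.
rewrite (integrable_quad _ _ _ (fin t t0)).2 -/(mt t) -/(Ct t).
set S := second_moment _; set C := Ct t.
have Csym : C^T = C := cov_sym (rho t).
have Ssym : S^T = S.
  apply/matrixP => k l; rewrite !mxE; apply: eq_Rintegral => u _.
  exact: mulrC.
move: (M) (gram_sym) => N Nsym.
have tr_entry (X : 'M[R]_n) k l : X^T k l = X l k by rewrite mxE.
have e1 : \tr ((- ((delta_mx i j + delta_mx j i) *m (C *m N)))^T *m S) =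
    - (S *m N *m C) i j - (C *m N *m S) i j.
  rewrite -mxtrace_tr trmx_mul trmxK Ssym mulmxN linearN/= mxtrace_mulC.
  rewrite -[in LHS]mulmxA mulmxDl mxtraceD !trace_delta_mul opprD; congr (- _ - _).
  by rewrite -tr_entry !trmx_mul Ssym Csym Nsym mulmxA.
have e2 : (((delta_mx i j + delta_mx j i) *m (C *m beta) -
      (C *m N)^T *m 0)^T *m mean (rho t)) 0 0 =
    mt t i 0 * (C *m beta) j 0 + (C *m beta) i 0 * mt t j 0.
  rewrite mulmx0 subr0 trmx_mul linearD/= !trmx_delta mulmxDr mulmxDl mxE.
  by rewrite !delta_mx_form [X in X + _]mulrC.
have e3 : \tr ((delta_mx i j + delta_mx j i) *m (C *m N *m C)) =
    2 * (C *m N *m C) i j.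
  rewrite mulmxDl mxtraceD !trace_delta_mul.
  by rewrite -tr_entry !trmx_mul Csym Nsym mulmxA mulr_natl.
rewrite trmx_delta e1 e2 e3 trmx0 mul0mx mulKf ?pnatr_eq0//.
by rewrite /= !mxE !big_ord1 !mxE add0r addrA.
Qed.

(** Subtracting the derivative of m m^T from that of the second moment cancels all terms in m. The
    drift leaves - 2 C M C and the diffusion adds C M C. *)
Lemma cov_ode : halfline_diffmx Ct (fun t => - (Ct t *m M *m Ct t)).
Proof.
have fin := rho_sol.1.
apply: (eq_halfline_diffmx (halfline_diffmxB second_moment_ode
   (halfline_diffmxM mean_ode (halfline_diff_trmx mean_ode)))) => t t0.
  by rewrite (second_momentE (fin t t0)) addrK.
rewrite (second_momentE (fin t t0)) -/(mt t) -/(Ct t).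
set C := Ct t; set v := mt t.
have Csym : C^T = C := cov_sym (rho t).
move: (M) (gram_sym) => N Nsym.
move: (beta) => bt.
have key (X Y Z W U : 'M[R]_n) : - (X + Y) - (X + Z) + W + U + X +
    (- - Z - U + (- - Y - W)) = - X.
  by apply/matrixP => a b; rewrite !mxE; ring.
rewrite !(mulmxDl, mulmxDr) !linearD/= linearN/= !trmx_mul Csym Nsym.
by rewrite !(mulmxDl, mulmxDr, mulmxN, mulNmx, mulmxA) key.
Qed.

End MomentEquations.

(** * Closed forms of the covariance and the mean *)

Section ClosedForm.
Context {R : realType} {n : nat}.
Variables (M : 'M[R]_n) (C : R -> 'M[R]_n) (mt : R -> 'cV[R]_n).
Hypothesis C_ode : halfline_diffmx C (fun t => - (C t *m M *m C t)).
Hypothesis C0_unit : C 0 \in unitmx.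

Let CM_continuous i j :
  {within [set t | 0 <= t], continuous (fun t => (- (C t *m M)) i j)}.
Proof.
have -> : (fun t => (- (C t *m M)) i j) = fun t => (C t *m - M) i j.
  by apply/funext => t; rewrite mulmxN.
exact: (halfline_diffmxM C_ode (halfline_diffmx_cst (- M)) i j).2.
Qed.

(** For X = C (C0^-1 + t M) - 1 the product rule gives X' = - C M C (C0^-1 + t M) + C M = - C M X,
    and X(0) = 0. *)
Lemma riccati_solution t : 0 <= t -> C t *m (invmx (C 0) + t *: M) = 1%:M.
Proof.
move=> t0; apply/eqP; rewrite -subr_eq0; apply/eqP.
apply: (linear_ode_zero (X := fun t => C t *m (invmx (C 0) + t *: M) - 1%:M)
  CM_continuous) => //; last by rewrite scale0r addr0 mulmxV// subrr.
have dM : halfline_diffmx (fun t => invmx (C 0) + t *: M) _ :=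
  halfline_diffmxD (halfline_diffmx_cst (invmx (C 0)))
    (halfline_diffmxZ (@halfline_diff_id R) (halfline_diffmx_cst M)).
apply: (eq_halfline_diffmx
  (halfline_diffmxB (halfline_diffmxM C_ode dM) (halfline_diffmx_cst 1%:M))) => // s _.
rewrite add0r scale1r scaler0 addr0 subr0 mulmxBr mulmx1 !mulNmx opprK.
by rewrite !mulmxA.
Qed.

(** The difference of the two sides solves X' = - C M X from zero. Differentiating t C b gives C b -
    C M (t C b), which accounts for the forcing by b. *)
Lemma linear_mean_solution (u b : 'cV[R]_n) t :
  halfline_diffmx mt (fun t => - (C t *m M *m mt t) + C t *m (M *m u + b)) ->
  0 <= t ->
  mt t = mt 0 + (1%:M - C t *m invmx (C 0)) *m (u - mt 0) + t *: (C t *m b).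
Proof.
move=> m_ode t0; apply/eqP; rewrite -subr_eq0; apply/eqP.
apply: (linear_ode_zero (X := fun t => mt t - (mt 0 +
  (1%:M - C t *m invmx (C 0)) *m (u - mt 0) + t *: (C t *m b)))
  CM_continuous) => //; last first.
  by rewrite scale0r addr0 mulmxV// subrr mul0mx addr0 subrr.
have dC (p : nat) (K : 'M[R]_(n, p)) := halfline_diffmxM C_ode (halfline_diffmx_cst K).
apply: (eq_halfline_diffmx (halfline_diffmxB m_ode (halfline_diffmxD
  (halfline_diffmxD (halfline_diffmx_cst (mt 0))
    (halfline_diffmxM (halfline_diffmxB (halfline_diffmx_cst 1%:M) (dC _ _))
       (halfline_diffmx_cst (u - mt 0))))
  (halfline_diffmxZ (@halfline_diff_id R) (dC _ b))))) => // s _.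
have key (x1 x2 x3 x4 x5 x6 x7 : 'cV[R]_n) :
    - x1 + (x3 + x4) - (x5 - x6 + (x4 - x7)) =
    - (x1 - (x2 + (x3 - x2 + (- x5 - - x6)) + x7)).
  by apply/colP => k; rewrite !mxE; ring.
rewrite !mulmx0 !addr0 !(add0r, sub0r) scale1r !mulNmx opprK.
rewrite !(mulmxDr, mulmxBr, mulmxDl, mulmxBl, mulmxN, mulNmx, mul1mx, mulmxA).
by rewrite -scalemxAr scalerN !mulmxA; exact: key.
Qed.

End ClosedForm.

(** * Long-time limit *)

Lemma spd_unit (R : realType) (n : nat) (H : 'M[R]_n) : spd H -> H \in unitmx.
Proof.
move=> Hspd; rewrite -row_free_unit -kermx_eq0; apply/eqP.
have kH : kermx H *m H = 0 by apply: mulmx_ker.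
apply: trmx_inj; rewrite trmx0; apply: (spd_form_eq0 Hspd) => j.
by rewrite trmxK kH mul0mx mxE.
Qed.

Lemma spd_inv (R : realType) (n : nat) (H : 'M[R]_n) : spd H -> spd (invmx H).
Proof.
move=> Hspd; have Hu := spd_unit Hspd; have [Hsym Hpos] := Hspd.
split=> [|x x0]; first by rewrite trmx_inv Hsym.
have -> : x^T *m invmx H *m x = (invmx H *m x)^T *m H *m (invmx H *m x).
  by rewrite trmx_mul trmx_inv Hsym mulmxA mulmxKV// mulmxA.
apply: Hpos; apply: contraNneq x0 => Hx.
by rewrite -(mulKVmx Hu x) Hx mulmx0.
Qed.

(** Commutation gives K N' = K N' K N = K N, so both inverses define the same projector. This makes
    the generalised inverse independent of the chosen diagonalization. *)
Lemma group_inverse_unique (R : pzRingType) (n : nat) (K N N' : 'M[R]_n) :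
  K *m N = N *m K -> K *m N *m K = K -> N *m K *m N = N ->
  K *m N' = N' *m K -> K *m N' *m K = K -> N' *m K *m N' = N' -> N = N'.
Proof.
move=> c1 k1 n1 c2 k2 n2.
have QQ' : K *m N = K *m N'.
  have -> : K *m N' = K *m N' *m (K *m N).
    by rewrite c2 c1 -mulmxA [K *m (N *m K)]mulmxA k1.
  by rewrite mulmxA k2.
by rewrite -n1 -mulmxA QQ' mulmxA -c1 QQ' c2 n2.
Qed.

(** * Decay of order 1/t *)

Section Rate.
Context {R : realType}.

(** One constant serves all t > 0 and all entries; both the limits and the final Euclidean rate are
    deduced from this bound. *)
Definition rate_inv (m n : nat) (X : R -> 'M[R]_(m, n)) : Prop :=
  exists B : R, forall t, 0 < t -> forall i j, `|X t i j| <= B * t^-1.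

Lemma eq_rate_inv (m n : nat) (X Y : R -> 'M[R]_(m, n)) :
  (forall t, 0 < t -> X t = Y t) -> rate_inv X -> rate_inv Y.
Proof. by move=> XY [B XB]; exists B => t t0 i j; rewrite -XY//; exact: XB. Qed.

Lemma rate_inv_mulmxr (m n p : nat) (X : R -> 'M[R]_(m, n)) (Y : 'M[R]_(n, p)) :
  rate_inv X -> rate_inv (fun t => X t *m Y).
Proof.
move=> [B XB]; exists (B * \sum_k \sum_j `|Y k j|) => t t0 i j.
rewrite mxE (le_trans (ler_norm_sum _ _ _))// mulrAC mulr_sumr ler_sum// => k _.
rewrite normrM ler_pM//; first exact: XB.
by rewrite (bigD1 j)//= lerDl sumr_ge0.
Qed.

Lemma rate_inv_cvg (m n : nat) (X : R -> 'M[R]_(m, n)) (L : 'M[R]_(m, n)) :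
  rate_inv (fun t => X t - L) -> X t @[t --> +oo] --> L.
Proof.
move=> [B XB]; apply/cvgrPdist_le => e e0; near=> t.
have t0 : 0 < t by near: t; exact: nbhs_pinfty_gt.
rewrite -normrN opprB /Num.norm/= mx_normrE; apply/bigmax_leP; split=> [|ij _].
  exact: ltW.
by rewrite (le_trans (XB t t0 _ _))// ler_pdivrMr// -ler_pdivrMl.
Unshelve. all: by end_near. Qed.

Lemma rate_inv_enorm (n : nat) (X : R -> 'cV[R]_n) : rate_inv X ->
  exists K : R, \forall t \near +oo, enorm (X t) <= K * t^-1.
Proof.
(* The Euclidean norm is at most sqrt n times the largest absolute entry. *)
move=> [B XB]; exists (Num.sqrt n%:R * `|B|); near=> t.
have t0 : 0 < t by near: t; exact: nbhs_pinfty_gt.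
have ti0 : 0 <= t^-1 by rewrite invr_ge0 ltW.
have -> : Num.sqrt n%:R * `|B| * t^-1 = Num.sqrt (n%:R * (B * t^-1) ^+ 2).
  by rewrite sqrtrM ?ler0n// sqrtr_sqr normrM (ger0_norm ti0) mulrA.
rewrite /enorm ler_wsqrtr// mxE.
have -> : n%:R * (B * t^-1) ^+ 2 = \sum_(k < n) (B * t^-1) ^+ 2.
  by rewrite sumr_const card_ord mulr_natl.
apply: ler_sum => k _; rewrite mxE -expr2 -real_normK ?num_real//.
by rewrite lerXn2r ?nnegrE// ?(le_trans _ (XB t t0 k 0))//; exact: XB.
Unshelve. all: by end_near. Qed.

End Rate.

(** * Group inverse and resolvent of a diagonalizable operator *)

Section Diagonalization.
Context {R : realType} {n : nat}.
Variables (K S : 'M[R]_n) (k : nat) (mu : nat -> R).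
Hypothesis KS : is_diagonalization K S k mu.

Let N : 'M[R]_n := S *m pad_diag n k (fun i => (mu i)^-1) *m invmx S.

Lemma mul_conj_diag (d e : 'rV[R]_n) :
  (S *m diag_mx d *m invmx S) *m (S *m diag_mx e *m invmx S) =
  S *m diag_mx (\row_i (d 0 i * e 0 i)) *m invmx S.
Proof.
have [Su _ _ _ _] := KS; rewrite -!mulmxA (mulKmx Su) (mulmxA (diag_mx d)).
by rewrite mulmx_diag.
Qed.

Lemma diagonalization_group_inverse :
  [/\ K *m N = N *m K, K *m N *m K = K & N *m K *m N = N].
Proof.
have [_ _ mu0 _ KE] := KS; rewrite KE /N /pad_diag.
by split; rewrite !mul_conj_diag; congr (_ *m diag_mx _ *m _);
  apply/rowP => i; rewrite !mxE; case: ifPn => ik; rewrite ?mul0r ?mulr0//;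
  have := mu0 i ik; [rewrite mulrC| |] => m0; rewrite ?mulfK ?mulVf ?mulfV ?mul1r ?gt_eqF.
Qed.

Lemma resolvent_rate : exists Rt : R -> 'M[R]_n,
  (forall t, 0 <= t -> (1%:M + t *: K) *m Rt t = 1%:M) /\
  rate_inv (fun t => Rt t - (1%:M - K *m N)).
Proof.
have [Su _ mu0 _ KE] := KS.
pose d : 'rV[R]_n := \row_i if (i < k)%N then mu i else 0.
have d0 i : 0 <= d 0 i by rewrite mxE; case: ifPn => // ik; exact/ltW/mu0.
have KdE : K = S *m diag_mx d *m invmx S by [].
have oneE : 1%:M = S *m diag_mx (const_mx 1) *m invmx S.
  by rewrite diag_const_mx mulmx1 mulmxV.
pose r t : 'rV[R]_n := \row_i (1 + t * d 0 i)^-1.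
exists (fun t => S *m diag_mx (r t) *m invmx S); split=> [t t0|].
  have -> : 1%:M + t *: K = S *m diag_mx (const_mx 1 + t *: d) *m invmx S.
    by rewrite linearD linearZ/= mulmxDr mulmxDl -oneE KdE -scalemxAr -scalemxAl.
  rewrite mul_conj_diag [RHS]oneE; congr (_ *m diag_mx _ *m _).
  apply/rowP => i; have := d0 i; rewrite !mxE => di.
  by rewrite mulfV// gt_eqF// ltr_pwDl// mulr_ge0.
(* The eigenvalues of the resolvent minus those of the projector 1 - K N: on the kernel of [K] both
   are 1 and cancel, elsewhere the projector contributes 0. *)
pose e t : 'rV[R]_n := \row_i if (i < k)%N then (1 + t * mu i)^-1 else 0.
have E t : S *m diag_mx (r t) *m invmx S - (1%:M - K *m N) =
    S *m diag_mx (e t) *m invmx S.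
  rewrite oneE KdE /N /pad_diag mul_conj_diag.
  rewrite -!mulmxBl -!mulmxBr -!linearB/=; congr (_ *m diag_mx _ *m _).
  apply/rowP => i; rewrite !mxE; case: ifPn => ik.
    by rewrite mulfV ?gt_eqF ?mu0// subrr subr0.
  by rewrite mulr0 addr0 invr1 mul0r subr0 subrr.
have [B eB] : exists B, forall t, 0 < t -> forall i, `|e t 0 i| <= B * t^-1.
  (* From 1 / (1 + t mu) <= mu^-1 t^-1; the sum of these constants bounds each of them. *)
  pose c (i : 'I_n) := if (i < k)%N then (mu i)^-1 else 0.
  have c0 i : 0 <= c i.
    by rewrite /c; case: ifPn => // ik; rewrite invr_ge0 ltW// mu0.
  exists (\sum_i c i) => t t0 i; apply: (@le_trans _ _ (c i * t^-1)).
    rewrite mxE /c; case: ifPn => ik; last by rewrite normr0 mul0r.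
    have mui := mu0 i ik; have tmu : 0 < t * mu i by rewrite mulr_gt0.
    rewrite ger0_norm ?invr_ge0 ?addr_ge0 ?(ltW tmu)// -invfM [mu i * t]mulrC.
    by rewrite lef_pV2 ?posrE ?addr_gt0// lerDr.
  rewrite ler_pM2r ?invr_gt0// (bigD1 i)//= lerDl.
  by rewrite sumr_ge0.
rewrite (_ : (fun t => _) = fun t => S *m diag_mx (e t) *m invmx S); last first.
  exact/funext.
apply: rate_inv_mulmxr.
exists (B * \sum_i \sum_j `|S i j|) => t t0 i j.
rewrite mul_mx_diag mxE normrM mulrC mulrAC ler_pM//; first exact: eB.
rewrite (bigD1 i)//= (bigD1 j)//= -addrA lerDl addr_ge0// sumr_ge0// => l _.
by rewrite sumr_ge0.
Qed.

End Diagonalization.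

(** * Kernel projector, normal equations and minimal norm *)

Section LeastSquares.
Context {R : realType} {m n : nat}.
Variables (A : 'M[R]_(m, n)) (G : 'M[R]_m) (C0 K N : 'M[R]_n).
Hypotheses (G_spd : spd G) (C0_spd : spd C0).

Hypothesis KE : K = C0 *m A^T *m invmx G *m A.
Hypotheses (KN_comm : K *m N = N *m K) (KNK : K *m N *m K = K).

Let M_eq0 (p : nat) (X : 'M[R]_(n, p)) : K *m X = 0 -> A^T *m invmx G *m A *m X = 0.
Proof.
move=> /(congr1 (mulmx (invmx C0))).
by rewrite KE !mulmxA mulVmx ?spd_unit// mul1mx mulmx0.
Qed.

(** K P = 0 gives A^T G^-1 A P = 0 because [C0] is invertible, so the Gram matrix of A P for G^-1
    vanishes. *)
Lemma mulmx_kernel_projector : A *m (1%:M - K *m N) = 0.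
Proof.
set P := 1%:M - _; have KP : K *m P = 0.
  by rewrite mulmxBr mulmx1 KN_comm mulmxA KNK subrr.
apply: (spd_form_eq0 (spd_inv G_spd)) => j.
by rewrite trmx_mul -!mulmxA !(mulmxA A^T) (mulmxA _ A) M_eq0 // mulmx0 mxE.
Qed.

(** The Gram matrix of (P C0 A^T)^T for G^-1 is P K C0 P^T, and P K = 0. *)
Lemma kernel_projector_cov : (1%:M - K *m N) *m C0 *m A^T = 0.
Proof.
set P := 1%:M - _; have PK : P *m K = 0 by rewrite mulmxBl mul1mx KNK subrr.
apply: trmx_inj; rewrite trmx0; apply: (spd_form_eq0 (spd_inv G_spd)) => j.
rewrite trmxK !trmx_mul trmxK !mulmxA.
have -> : P *m C0 *m A^T *m invmx G *m A = P *m K by rewrite KE !mulmxA.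
by rewrite PK !mul0mx mxE.
Qed.

(** After multiplication by [C0] the defect of this normal equation is (1 - K N) C0 A^T G^-1 z,
    which vanishes by [kernel_projector_cov]. *)
Lemma gram_preconditioned_solution (z : 'cV[R]_m) :
  A^T *m invmx G *m A *m (N *m (C0 *m (A^T *m invmx G *m z))) = A^T *m invmx G *m z.
Proof.
apply: (can_inj (mulKmx (spd_unit C0_spd))).
rewrite !mulmxA -KE; apply/eqP; rewrite eq_sym -subr_eq0; apply/eqP.
have -> : C0 *m A^T *m invmx G *m z - K *m N *m C0 *m A^T *m invmx G *m z =
    (1%:M - K *m N) *m C0 *m A^T *m invmx G *m z.
  by rewrite !mulmxBl !mul1mx.
by rewrite kernel_projector_cov !mul0mx.
Qed.

Lemma kernel_projector_argmin (m0 x : 'cV[R]_n) :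
  is_argmin [set v | A *m v = A *m x] (fun v => wnorm C0 (v - m0))
    (m0 + K *m N *m (x - m0)).
Proof.
set q := K *m N *m (x - m0).
have Aq : A *m (m0 + q) = A *m x.
  apply/eqP; rewrite -subr_eq0 -mulmxBr; apply/eqP.
  have -> : m0 + q - x = - ((1%:M - K *m N) *m (x - m0)).
    by rewrite /q mulmxBl mul1mx opprB opprB addrCA addrA.
  by rewrite mulmxN mulmxA mulmx_kernel_projector mul0mx oppr0.
split=> // v /= Av vq; rewrite /wnorm.
have [C0sym _] := C0_spd.
set d := v - (m0 + q); have Ad : A *m d = 0 by rewrite mulmxBr Av Aq subrr.
have d0 : d != 0 by rewrite subr_eq0; apply/eqP.
have -> : v - m0 = q + d by apply/colP => i; rewrite !mxE; ring.
rewrite addrAC subrr add0r.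
have qd : q^T *m invmx C0 *m d = 0.
  (* Since K^T C0^-1 = A^T G^-1 A, the inner product of q = K N (x - m0) with d contains the factor
     A d = 0: q is orthogonal to the kernel of [A]. *)
  have KC : K^T *m invmx C0 = A^T *m invmx G *m A.
    rewrite KE !trmx_mul trmxK trmx_inv G_spd.1 C0sym !mulmxA.
    by rewrite mulmxK ?spd_unit.
  by rewrite /q !trmx_mul -!mulmxA (mulmxA K^T) KC -!mulmxA Ad !mulmx0.
clearbody q.
have dq : d^T *m invmx C0 *m q = 0.
  by apply: trmx_inj; rewrite !trmx_mul trmxK trmx_inv C0sym mulmxA qd trmx0.
clearbody d.
have dd := (spd_inv C0_spd).2 d d0.
have qq := spd_form_ge0 q 0 (spd_inv C0_spd).
have -> : wdot C0 (q + d) (q + d) = wdot C0 q q + wdot C0 d d.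
  have trE : (q + d)^T = q^T + d^T by rewrite linearD.
  by rewrite /wdot trE !(mulmxDl, mulmxDr) qd dq addr0 add0r mxE.
by rewrite ltr_sqrt ?ltrDl// ltr_wpDl.
Qed.

(** The normal equation says that the residual is orthogonal to every A z. Positive definiteness
    makes such a point unique, so [xget] returns it and not its default. *)
Lemma orth_proj_ran (y : 'cV[R]_m) (x : 'cV[R]_n) :
  A^T *m invmx G *m (y - A *m x) = 0 -> orth_proj G (ran A) y = A *m x.
Proof.
move=> normal; have [Gsym _] := G_spd.
have proj_unique p p' : is_orth_proj G (ran A) y p ->
    is_orth_proj G (ran A) y p' -> p = p'.
  move=> [[a _ <-] pV] [[a' _ <-] pV'].
  apply/eqP; rewrite -subr_eq0; apply/eqP.
  apply: (spd_form_eq0 (spd_inv G_spd)) => j; rewrite ord1.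
  have ra : ran A (A *m a - A *m a') by exists (a - a') => //; rewrite mulmxBr.
  have := pV _ ra; have := pV' _ ra; rewrite /wdot => e' e.
  have -> : (A *m a - A *m a')^T = (y - A *m a')^T - (y - A *m a)^T.
    by apply/matrixP => k l; rewrite !mxE; ring.
  by rewrite 2!mulmxBl mxE e' mxE e subrr.
suff xV : is_orth_proj G (ran A) y (A *m x).
  by apply: xget_unique => // p pV; exact: proj_unique pV xV.
split; first by exists x.
move=> _ [z _ <-]; rewrite /wdot.
have -> : (y - A *m x)^T *m invmx G *m (A *m z) =
    (A^T *m invmx G *m (y - A *m x))^T *m z.
  by rewrite !trmx_mul trmxK trmx_inv Gsym !mulmxA.
by rewrite normal trmx0 mul0mx mxE.
Qed.

End LeastSquares.

(** * Formula, limits, minimizers and rate for the mean *)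

Unset Implicit Arguments.
Set Strict Implicit.
Set Printing Implicit Defensive.

Theorem theorem3p2 (R : realType) (m n : nat)
    (A : 'M[R]_(m, n)) (G : 'M[R]_m) (y ydag eps : 'cV[R]_m)
    (rho : R -> probability (borel_cV R n) R) (u : 'cV[R]_n)
    (mt : R -> 'cV[R]_n) (Ct : R -> 'M[R]_n)
    (m0 : 'cV[R]_n) (C0 : 'M[R]_n)
    (mtE : mt = fun t => mean (rho t)) (CtE : Ct = fun t => cov (rho t))
    (m0E : m0 = mt 0) (C0E : C0 = Ct 0)
    (G_spd : spd G) (C0_spd : spd C0)
    (yE : y = ydag + eps) (ydag_ran : ran A ydag)
    (rho_sol : mean_field_eki A G y rho)
    (Au : A *m u = ydag) :
  (forall t, 0 <= t ->
     mt t = m0 + (1%:M - Ct t *m invmx C0) *m (u - m0)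
            + t *: (Ct t *m A^T *m invmx G *m eps)) /\
  exists (Cinf : 'M[R]_n) (minf : 'cV[R]_n),
    let mdag : 'cV[R]_n := m0 + (1%:M - Cinf *m invmx C0) *m (u - m0) in
    Ct t @[t --> +oo] --> Cinf /\
    mt t @[t --> +oo] --> minf /\
    (exists (S : 'M[R]_n) (k : nat) (mu : nat -> R),
       is_diagonalization (C0 *m A^T *m invmx G *m A) S k mu) /\
    (forall (S : 'M[R]_n) (k : nat) (mu : nat -> R),
       is_diagonalization (C0 *m A^T *m invmx G *m A) S k mu ->
       minf = mdag + ginv C0 S k mu *m (A^T *m invmx G *m eps)) /\
    is_argmin [set v | A *m v = ydag] (fun v => wnorm C0 (v - m0)) mdag /\
    is_argmin [set v | A *m v = orth_proj G (ran A) y]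
      (fun v => wnorm C0 (v - m0)) minf /\
    (exists K : R, \forall t \near +oo, enorm (mt t - minf) <= K * t^-1).
Proof.
subst mt Ct m0 C0.
set C0 := cov (rho 0) in C0_spd *; set m0 := mean (rho 0).
have C0u : C0 \in unitmx := spd_unit C0_spd.
have [Gsym _] := G_spd; have [C0sym _] := C0_spd.
set b := A^T *m invmx G *m eps.
set M := A^T *m invmx G *m A.
set K := C0 *m A^T *m invmx G *m A.
have KE : K = C0 *m A^T *m invmx G *m A by [].
have KM : K = C0 *m M by rewrite KE /M !mulmxA.
have Cb t : cov (rho t) *m A^T *m invmx G *m eps = cov (rho t) *m b.
  by rewrite /b !mulmxA.
have mE t : 0 <= t -> mean (rho t) =
    m0 + (1%:M - cov (rho t) *m invmx C0) *m (u - m0) + t *: (cov (rho t) *m b).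
  move=> t0; have m_ode := mean_ode rho_sol.
  (* As y = A u + eps, the forcing splits into M u and the noise term b. *)
  rewrite (_ : A^T *m invmx G *m y = M *m u + b) in m_ode; last first.
    by rewrite yE -Au mulmxDr /M !mulmxA.
  exact: (linear_mean_solution (cov_ode rho_sol Gsym) C0u m_ode t0).
split=> [t t0|]; first by rewrite mE// Cb.
have [S [k [mu KS]]] : exists S k mu, is_diagonalization K S k mu.
  have C0K : invmx C0 *m K = M by rewrite KM mulKmx.
  apply: (diagonalizable_psd (spd_inv C0_spd)); rewrite C0K.
    exact: gram_sym.
  move=> x; have := spd_form_ge0 (A *m x) 0 (spd_inv G_spd).
  by rewrite trmx_mul /M !mulmxA.
have [KN KNK NKN] := diagonalization_group_inverse KS.
set N := S *m _ *m _ in KN KNK NKN.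
have [Rt [RtE Rt_rate]] := resolvent_rate KS; rewrite -/N in Rt_rate.
set P := 1%:M - K *m N in Rt_rate.
(* Since M w = b, the noise acts like a shift of the truth from u to u + w. *)
pose w := N *m (C0 *m b).
have Mw : M *m w = b.
  exact: (gram_preconditioned_solution G_spd C0_spd KE KNK eps).
(* Multiply the Riccati identity by R C0 on the right, using C0^-1 + t M = C0^-1 (1 + t K). *)
have CE t : 0 <= t -> cov (rho t) = Rt t *m C0.
  move=> t0; have := riccati_solution (cov_ode rho_sol Gsym) C0u t0.
  rewrite -/C0 -/M => /(congr1 (fun X => X *m (Rt t *m C0))).
  rewrite mul1mx -mulmxA => <-.
  have -> : (invmx C0 + t *: M) *m (Rt t *m C0) = 1%:M; last by rewrite mulmx1.
  apply: (can_inj (mulKmx C0u)).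
  by rewrite !mulmxA mulmxDr mulmxV// -scalemxAr -KM RtE// mul1mx mulmx1.
have mRt t : 0 <= t -> mean (rho t) = m0 + (1%:M - Rt t) *m (u + w - m0).
  move=> t0; rewrite mE// CE// mulmxK// -Mw.
  (* The term equals t R K w, and R (1 + t K) = 1 turns t R K into 1 - R. *)
  have -> : t *: (Rt t *m C0 *m (M *m w)) = (1%:M - Rt t) *m w.
    have RtC : Rt t *m (1%:M + t *: K) = 1%:M by apply: mulmx1C; exact: RtE.
    rewrite -{1}RtC mulmxDr mulmx1 addrAC subrr add0r -scalemxAr -scalemxAl.
    by rewrite KM !mulmxA.
  by rewrite -addrA -mulmxDr [u - m0 + w]addrAC.
(* Both limits come from replacing R(t) by P, with 1 - P = K N. *)
exists (P *m C0), (m0 + K *m N *m (u + w - m0)) => /=.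
have mdagE : m0 + (1%:M - P *m C0 *m invmx C0) *m (u - m0) =
    m0 + K *m N *m (u - m0).
  by rewrite mulmxK// /P subKr.
rewrite mdagE.
have m_rate : rate_inv (fun t => (Rt t - P) *m (- (u + w - m0))).
  exact: rate_inv_mulmxr.
have mdiff t : 0 <= t -> mean (rho t) - (m0 + K *m N *m (u + w - m0)) =
    (Rt t - P) *m (- (u + w - m0)).
  move=> t0; rewrite mRt// /P mulmxN -mulNmx.
  rewrite opprD addrACA subrr add0r -mulmxBl; congr (_ *m _).
  by rewrite KN; apply/matrixP => i j; rewrite !mxE; ring.
split; [|split; [|split; [|split; [|split; [|split]]]]].
- apply: rate_inv_cvg.
  have := rate_inv_mulmxr C0 Rt_rate; apply: eq_rate_inv => t t0.
  by rewrite CE ?(ltW t0)// mulmxBl.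
- apply: rate_inv_cvg; apply: eq_rate_inv m_rate => t t0.
  by rewrite mdiff ?(ltW t0).
- by exists S, k, mu.
(* An arbitrary diagonalization gives the same group inverse [N]; then K N w = w because N K N =
   N. *)
- move=> S' k' mu' KS'; have [KN' KNK' NKN'] := diagonalization_group_inverse KS'.
  rewrite /ginv -(group_inverse_unique KN KNK NKN KN' KNK' NKN').
  have -> : u + w - m0 = (u - m0) + w by rewrite addrAC.
  rewrite [in LHS]mulmxDr addrA; congr (_ + _).
  by rewrite /w mulmxA KN NKN mulmxA.
- by rewrite -Au; exact: (kernel_projector_argmin G_spd C0_spd KE KN KNK).
(* The residual y - A (u + w) = eps - A w satisfies the normal equation by M w = b, so A (u + w) is
   the projection of y. *)
- rewrite (orth_proj_ran G_spd (x := u + w)); last first.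
    have -> : y - A *m (u + w) = eps - A *m w.
      by rewrite yE -Au mulmxDr opprD addrACA subrr add0r.
    by rewrite mulmxBr mulmxA -/M Mw subrr.
  exact: (kernel_projector_argmin G_spd C0_spd KE KN KNK).
- apply: rate_inv_enorm; apply: eq_rate_inv m_rate => t t0.
  by rewrite mdiff ?(ltW t0).
Qed.
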